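(* For integers $m\ge n\ge 1$, $$q(T_{m,n}^c)=\begin{cases}1, & (m,n)=(1,1),\\ 4, & (m,n)=(2,2),\\ 3, & (m,n)\in\{(2,1),(3,1),(4,1),(3,2)\},\\ 2, & \text{otherwise.}\end{cases}$$ In particular, for $(m,n)\neq(2,2)$, the graphs $G=T_{m,n}$ and $G=T_{m,n}^c$ satisfy the inequality $q(G)+q(G^c)\le |G|+2$.
   Context: All graphs are finite, undirected and simple; $|G|$ is the number of vertices of $G$, and $G^c$ is the complement of $G$. For a graph $G$ with vertex set $\{1,\dots,n\}$, $S(G)$ is the set of all real symmetric $n\times n$ matrices $A=(a_{ij})$ such that for $i\ne j$, $a_{ij}\neq 0$ if and only if $\{i,j\}$ is an edge of $G$ (no restriction on the diagonal). $q(A)$ is the number of distinct eigenvalues of $A$, and $q(G)=\min\{q(A): A\in S(G)\}$. For $m,n\ge 1$, $T_{m,n}$ is the graph on $m+n+1$ vertices obtained from the path $P_{m+n+1}$ with vertices $1,2,\dots,m+n+1$ in order by adding the extra edge $\{m,m+2\}$ (so it is a triangle on $m,m+1,m+2$ with a path on $m$ vertices ending at $m$ and a path on $n$ vertices starting at $m+2$). *)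

(* Defs.v *)
From mathcomp Require Import all_boot all_order all_algebra.
From mathcomp Require Import finmap.
From mathcomp Require Import boolp classical_sets cardinality reals.

Set Implicit Arguments.
Unset Strict Implicit.
Unset Printing Implicit Defensive.

Import Order.TTheory GRing.Theory Num.Theory.
Local Open Scope classical_set_scope.
Local Open Scope ring_scope.

(* Vertices are numbered from 0: the ordinal i stands for the vertex i + 1. *)
Record sgraph (n : nat) := SGraph {
  adj : rel 'I_n;
  adj_sym : symmetric adj;
  adj_irr : irreflexive adj }.

Definition nvertices (n : nat) (G : sgraph n) : nat := n.

Section Complement.
Variables (n : nat) (G : sgraph n).

Definition compl_adj : rel 'I_n := fun i j => (i != j) && ~~ adj G i j.

Lemma compl_adj_sym : symmetric compl_adj.
Proof. by move=> i j; rewrite /compl_adj eq_sym adj_sym. Qed.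

Lemma compl_adj_irr : irreflexive compl_adj.
Proof. by move=> i; rewrite /compl_adj eqxx. Qed.

Definition compl : sgraph n := SGraph compl_adj_sym compl_adj_irr.
End Complement.

Section Tgraph.
Variables m n : nat.

Definition T_adj : rel 'I_(m + n).+1 := fun i j =>
  let u := i.+1 in let v := j.+1 in
  [|| v == u.+1, u == v.+1,
      (u == m) && (v == m.+2) | (v == m) && (u == m.+2)].

Lemma T_adj_sym : symmetric T_adj.
Proof.
by move=> i j; rewrite /T_adj /= orbCA; do 2 congr orb; rewrite orbC.
Qed.

Lemma T_adj_irr : irreflexive T_adj.
Proof.
move=> i; rewrite /T_adj /= orbb orbA orbb (ltn_eqF (ltnSn _)) /=.
by case: (eqVneq i.+1 m) => // e; rewrite e ltn_eqF.
Qed.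

Definition Tgraph : sgraph (m + n).+1 := SGraph T_adj_sym T_adj_irr.
End Tgraph.

Section Q.
Variable R : realType.

Definition spectrum (n : nat) (A : 'M[R]_n) : set R :=
  [set a | eigenvalue A a].

Lemma finite_spectrum (n : nat) (A : 'M[R]_n) : finite_set (spectrum A).
Proof.
have p0 : char_poly A != 0 by exact/monic_neq0/char_poly_monic.
apply: contrapT => infA.
have [B BA] := infinite_set_fset (size (char_poly A)) infA.
apply/negP; rewrite -ltnNge; apply: max_poly_roots; rewrite ?fset_uniq //.
by apply/allP => a /BA; rewrite /spectrum /= eigenvalue_root_char.
Qed.

(* fset_set returns the empty set on infinite sets; spectra are finite, see
   finite_spectrum. *)
Definition qmx (n : nat) (A : 'M[R]_n) : nat := #|` fset_set (spectrum A)|.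

Definition S_of (n : nat) (G : sgraph n) : set 'M[R]_n :=
  [set A | A^T = A /\ forall i j, i != j -> (A i j != 0 <-> adj G i j)].

Lemma q_values_neq0 (n : nat) (G : sgraph n) :
  exists k, `[< exists2 A, S_of G A & qmx A = k >].
Proof.
pose A : 'M[R]_n := \matrix_(i, j) (adj G i j)%:R.
exists (qmx A); apply/asboolP; exists A => //; split.
  by apply/matrixP=> i j; rewrite !mxE adj_sym.
by move=> i j _; rewrite mxE pnatr_eq0 eqb0 negbK.
Qed.

Definition q (n : nat) (G : sgraph n) : nat := ex_minn (q_values_neq0 G).

Lemma qP (n : nat) (G : sgraph n) :
  (exists2 A, S_of G A & qmx A = q G) /\
  (forall A, S_of G A -> (q G <= qmx A)%N).
Proof.
rewrite /q; case: ex_minnP => k /asboolP kP kmin; split=> // A SA.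
by apply: kmin; apply/asboolP; exists A.
Qed.
End Q.

(* Main.v *)
Require Import Defs.
From mathcomp Require Import all_boot all_order all_algebra.
From mathcomp Require Import reals.
From mathcomp Require Import finmap classical_sets cardinality.
From mathcomp Require Import complex ring lra zify.

Set Implicit Arguments.
Unset Strict Implicit.
Unset Printing Implicit Defensive.

Import Order.TTheory GRing.Theory Num.Theory.
Local Open Scope ring_scope.

(** A real symmetric matrix A is annihilated by the product of the X - a over its
distinct eigenvalues a ([horner_spectrum_poly], from the spectral theorem over
R[i]), so q(A) is the least degree of a monic polynomial annihilating A.  Both
kinds of bounds come from this.

Lower bounds.  If two vertices of G at distance k are joined by a unique
shortest path, the corresponding entry vanishes in A^0, ..., A^(k-1) but not in
A^k, for every A in S(G); so no monic polynomial of degree at most k annihilates A,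
and q(G) > k ([q_gt_geodesic]).  This gives all the lower bounds for T_{m,n}^c: any
edge gives 2, and paths of length 2, or 3 for (m,n) = (2,2), give the
exceptional values.

Upper bounds.  Assign to each vertex i a vector u_i of R^d so that, for
distinct i and j, u_i and u_j are orthogonal exactly when i and j are not
adjacent, and take weights c_i > 0.  The matrix A of the scalar products of the
sqrt(c_i) u_i is in S(G), and A p(A) = 0 as soon as p annihilates the d x d matrix
F = sum_i c_i u_i^T u_i ([q_le_gram]).  So q(T_{m,n}^c) is controlled by vectors
of R^3 in which orthogonality is adjacency in T_{m,n}; the triangle may be taken
to be the standard basis.  If F is scalar then q <= 2, if it is scalar plus a
rank one matrix then q <= 3, and q <= 4 always, by Cayley-Hamilton.

Increasing the weights of the standard basis changes the diagonal of F at will,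
so a scalar F only needs sum_i c_i (x_i y_i, x_i z_i, y_i z_i) = 0, the sum being over the
other m + n - 2 vertices.  For (5,1), (4,2) and (3,3) there are four of these,
and they can be chosen so that the four triples (x_i y_i, x_i z_i, y_i z_i)
positively span R^3 ([flexible]).  In such a position any new vector can be added
and compensated for, so the paths can be lengthened by one leaf at a time: the
new vector has to be orthogonal to that of the former end vertex and must avoid
finitely many planes ([leaf_vector]).  This covers all cases with
m + n + 1 >= 7.  The remaining ones are explicit.

The last claim follows from q(T_{m,n}) <= m + n: the edges of T_{m,n} are
covered by m + n - 1 cliques, and the indicator vectors of the cliques through
each vertex live in R^(m+n-1) ([q_Tgraph_le]). *)

(** * Distinct eigenvalues and annihilating polynomials *)

Section Annihilators.
Variables (R : realType) (n : nat).
Implicit Type A : 'M[R]_n.+1.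

Lemma qmx_lt_annihilator A (p : {poly R}) :
  p != 0 -> horner_mx A p = 0 -> (qmx A < size p)%N.
Proof.
move=> p0 /mxminpoly_min pA.
apply: max_poly_roots; rewrite ?fset_uniq //.
apply/allP => a; rewrite in_fset_set; last exact: finite_spectrum.
rewrite inE /spectrum /= eigenvalue_root_min.
by rewrite -!dvdp_XsubCl => /dvdp_trans; apply.
Qed.

Definition spectrum_poly A : {poly R} :=
  \prod_(a <- fset_set (spectrum A)) ('X - a%:P).

Lemma size_spectrum_poly A : size (spectrum_poly A) = (qmx A).+1.
Proof. exact: size_prod_XsubC. Qed.

(** Over R[i] a real symmetric matrix is unitarily diagonalizable with real
diagonal entries, each of which is an eigenvalue over R, hence a root of
[spectrum_poly A]. *)
Lemma horner_spectrum_poly A : A^T = A -> horner_mx A (spectrum_poly A) = 0.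
Proof.
move=> symA.
pose f := [the {rmorphism R -> R[i]} of real_complex R].
pose B := map_mx f A.
have realB : B \is a mxOver Num.real.
  apply/mxOverP => i j; rewrite mxE; apply/complex_realP; by exists (A i j).
have symB : B \is symmetricmx.
  apply/is_hermitianmxP; rewrite expr0 scale1r.
  by apply/matrixP => i j; rewrite !mxE -[in RHS]symA mxE.
have hermB := realsym_hermsym symB realB.
have /orthomx_spectralP eB := hermitian_normalmx hermB.
have realX := hermitian_spectral_diag_real hermB.
have unitP := spectral_unit B.
set P := spectralmx B in eB unitP; set X := spectral_diag B in eB realX.
apply: (map_mx_inj (f := f)).
rewrite map_mx0 map_horner_mx -/B eB horner_mx_uconjC // horner_mx_diag.
suff -> : map_mx (horner (map_poly f (spectrum_poly A))) X = 0.
  by rewrite (_ : diag_mx 0 = 0) ?mulmx0 ?mul0mx //; exact: raddf0.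
apply/rowP => j; rewrite !mxE.
have /complex_realP [r Xr] := mxOverP realX 0 j.
have rootr : root (spectrum_poly A) r.
  rewrite root_prod_XsubC in_fset_set; last exact: finite_spectrum.
  rewrite inE /spectrum /= eigenvalue_root_char -(fmorph_root f) map_char_poly.
  rewrite -/B [f r](esym Xr) -eigenvalue_root_char.
  apply/eigenvalueP; exists (delta_mx 0 j *m P).
    by rewrite eB !mulmxA mulmxK // scalemxAl -rowE row_diag_mx.
  apply: contraTneq unitP => /(congr1 (mulmx^~ (invmx P))).
  case: (boolP (P \in unitmx)) => // uP; rewrite mulmxK // mul0mx.
  by move/matrixP/(_ 0 j)/eqP; rewrite !mxE !eqxx oner_eq0.
by rewrite Xr -[X in _.[X]]/(f r) horner_map (rootP rootr) rmorph0.
Qed.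

(** A monic polynomial of degree k annihilating A would have the entry
(A^k)_ij as its (i, j) entry. *)
Lemma qmx_gt_power A k i j : A^T = A ->
  (forall t, (t < k)%N -> (A ^+ t) i j = 0) -> (A ^+ k) i j != 0 ->
  (k < qmx A)%N.
Proof.
move=> symA lowA; apply: contraNT; rewrite -leqNgt => le_q.
have mon : spectrum_poly A \is monic by apply: monic_prod_XsubC.
(* Multiplying by 'X^d brings the annihilating polynomial to degree k. *)
have [d kE] : exists d, k = (qmx A + d)%N.
  by exists (k - qmx A)%N; rewrite subnKC.
pose p := spectrum_poly A * 'X^d.
have sp : size p = k.+1.
  by rewrite size_Mmonic ?monic_neq0 ?monicXn // size_spectrum_poly size_polyXn
             kE /= addnS.
have monp : p \is monic by rewrite monicMl // monicXn.
have : horner_mx A p = 0 by rewrite rmorphM /= horner_spectrum_poly // mul0r.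
rewrite (_ : horner_mx A p = \sum_(t < k.+1) p`_t *: A ^+ t); last first.
  rewrite -[p in LHS]coefK poly_def sp raddf_sum; apply: eq_bigr => t _.
  by rewrite /= horner_mxZ rmorphXn /= horner_mx_X.
move/matrixP/(_ i j); rewrite big_ord_recr /= mxE summxE big1 => [|t _].
  move: monp; rewrite monicE lead_coefE sp /= => /eqP ->.
  by rewrite scale1r add0r mxE => ->.
by rewrite mxE lowA ?mulr0.
Qed.
End Annihilators.

(** * Lower bounds from unique shortest paths *)

Section Geodesics.
Variables (R : realType) (n : nat) (G : sgraph n.+1).

(** The function h certifies distances from x 0: it grows by at most one along
an edge, so the row x 0 of A^t vanishes where h > t.  The last hypothesis says
that x t is the only way to reach x t.+1 in one step from a vertex with h <= t,
which makes the entry of A^t.+1 at (x 0, x t.+1) a single nonzero product.  The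
diagonal of A is arbitrary, so walks may also stay in place; this is harmless
since h (x t.+1) > t. *)
Lemma q_gt_geodesic (h : 'I_n.+1 -> nat) (x : nat -> 'I_n.+1) k :
    (forall a b, adj G a b -> (h b <= (h a).+1)%N) ->
    (forall t, (t <= k)%N -> h (x t) = t) ->
    (forall t, (t < k)%N -> adj G (x t) (x t.+1)) ->
    (forall t y, (t < k)%N -> adj G y (x t.+1) -> (h y <= t)%N -> y = x t) ->
  (k < q R G)%N.
Proof.
move=> lip hx adjx uniqx.
have [[A [symA patA] <-] _] := qP R G.
have A0 a b : a != b -> ~~ adj G a b -> A a b = 0.
  move=> ab; apply: contraNeq => /eqP Aab.
  by case: (patA a b ab) => + _; apply; apply/eqP.
have far t : forall y, (t < h y)%N -> (A ^+ t) (x 0) y = 0.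
  elim: t => [|t IH] y ty.
    rewrite expr0 mxE; case: eqP ty => // <-; by rewrite hx.
  rewrite exprSr mxE big1 // => z _.
  case: (ltnP t (h z)) => [/IH ->|hz]; first by rewrite mul0r.
  rewrite A0 ?mulr0 //.
    by apply: contraTneq ty => <-; rewrite -leqNgt ltnW.
  by apply: contraL ty => /lip zy; rewrite -leqNgt (leq_trans zy).
apply: (qmx_gt_power (i := x 0) (j := x k) symA) => [t tk|].
  by apply: far; rewrite hx.
suff: forall t, (t <= k)%N -> (A ^+ t) (x 0) (x t) != 0 by apply.
elim=> [|t IH] tk; first by rewrite expr0 mxE eqxx oner_eq0.
rewrite exprSr mxE (bigD1 (x t)) //= big1 => [|z zx].
  rewrite addr0 mulf_neq0 ?IH ?(ltnW tk) //.
  case: (patA (x t) (x t.+1)) => [|_]; last by apply; apply: adjx.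
  by apply: contraTneq (adjx _ tk) => <-; rewrite adj_irr.
case: (ltnP t (h z)) => [/far ->|hz]; first by rewrite mul0r.
rewrite A0 ?mulr0 //.
  by apply: contraTneq hz => ->; rewrite hx // -ltnNge.
by apply: contra_neqN zx => /(uniqx t z tk); apply.
Qed.
End Geodesics.

(** * Upper bounds from Gram matrices *)

Section Gram.
Variables (R : realType) (n : nat) (G : sgraph n.+1).

(** The matrix A = M M^T and the frame operator F = M^T M satisfy
A^(t+1) = M F^t M^T, whence A p(A) = M p(F) M^T. *)
Lemma q_le_gram d (u : 'I_n.+1 -> 'rV[R]_d.+1) (c : 'I_n.+1 -> R)
    (p : {poly R}) :
    (forall i, 0 < c i) ->
    (forall i j, i != j -> ((u i *m (u j)^T) 0 0 != 0) = adj G i j) ->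
    p != 0 -> horner_mx (\sum_i c i *: ((u i)^T *m u i)) p = 0 ->
  (q R G <= size p)%N.
Proof.
move=> c0 pat p0; set F := (X in horner_mx X p) => pF.
pose M := \matrix_i (Num.sqrt (c i) *: u i).
have FE : F = M^T *m M.
  apply/matrixP => a b; rewrite !mxE summxE; apply: eq_bigr => i _.
  rewrite !mxE big_ord_recl big_ord0 !mxE addr0 mulrACA -expr2.
  by rewrite sqr_sqrtr // ltW.
pose A := M *m M^T.
have powA t : A ^+ t.+1 = M *m F ^+ t *m M^T.
  elim: t => [|t IH]; first by rewrite expr1 expr0 mulmx1.
  rewrite exprS IH [F ^+ t.+1]exprS {1}/A -!mulmxE FE !mulmxA.
  by rewrite -FE.
have pA : horner_mx A ('X * p) = 0.
  suff -> : horner_mx A ('X * p) = M *m horner_mx F p *m M^T.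
    by rewrite pF mulmx0 mul0mx.
  rewrite -[p]coefK poly_def mulr_sumr (raddf_sum (horner_mx A)).
  rewrite (raddf_sum (horner_mx F)) mulmx_sumr mulmx_suml.
  apply: eq_bigr => t _; rewrite -scalerAr -exprS /= !horner_mxZ.
  by rewrite !rmorphXn /= !horner_mx_X powA -scalemxAr -scalemxAl.
have SA : S_of G A.
  split; first by rewrite trmx_mul trmxK.
  move=> i j ij; rewrite -(pat i j ij).
  suff -> : A i j = Num.sqrt (c i) * Num.sqrt (c j) * (u i *m (u j)^T) 0 0.
    by rewrite !mulf_eq0 !sqrtr_eq0 !leNgt !c0; split.
  rewrite !mxE mulr_sumr; apply: eq_bigr => k _.
  by rewrite !mxE mulrACA.
have [_ /(_ _ SA) le_q] := qP R G; apply: (leq_trans le_q).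
have Xp0 : 'X * p != 0 by rewrite mulf_neq0 ?polyX_eq0.
by have := qmx_lt_annihilator Xp0 pA; rewrite mulrC size_mulX.
Qed.

Lemma q_le_gram_dim d (u : 'I_n.+1 -> 'rV[R]_d.+1) :
    (forall i j, i != j -> ((u i *m (u j)^T) 0 0 != 0) = adj G i j) ->
  (q R G <= d.+2)%N.
Proof.
move=> pat; pose F := \sum_i 1 *: ((u i)^T *m u i) : 'M_d.+1.
rewrite -(size_char_poly F).
apply: (@q_le_gram _ u (fun=> 1)) => //.
  exact/monic_neq0/char_poly_monic.
exact: Cayley_Hamilton.
Qed.
End Gram.

(** * Orthogonality in R^d *)

Section DotProduct.
Variables (R : realType) (d : nat).
Implicit Types x y z : 'rV[R]_d.

Definition dot x y : R := (x *m y^T) 0 0.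

Lemma dotE x y : dot x y = \sum_k x 0 k * y 0 k.
Proof. by rewrite /dot mxE; apply: eq_bigr => k _; rewrite mxE. Qed.

Lemma dotC x y : dot x y = dot y x.
Proof. by rewrite !dotE; apply: eq_bigr => k _; rewrite mulrC. Qed.

Lemma dotDl x y z : dot (x + y) z = dot x z + dot y z.
Proof. by rewrite /dot mulmxDl mxE. Qed.

Lemma dotZl a x z : dot (a *: x) z = a * dot x z.
Proof. by rewrite /dot -scalemxAl mxE. Qed.

Lemma dot0l z : dot 0 z = 0.
Proof. by rewrite /dot mul0mx mxE. Qed.

Lemma dot_eq0 x : (dot x x == 0) = (x == 0).
Proof.
apply/eqP/eqP => [|->]; last exact: dot0l.
rewrite dotE => /eqP; rewrite psumr_eq0; last first.
  by move=> k _; rewrite -expr2 sqr_ge0.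
move=> /allP x0; apply/rowP => k; rewrite mxE.
by have := x0 k (mem_index_enum _); rewrite mulf_eq0 orbb => /eqP.
Qed.

(** The component of y orthogonal to v is such an x. *)
Lemma exists_orth_neq0 v y : y != 0 -> (forall a, y != a *: v) ->
  exists2 x, dot x v = 0 & dot x y != 0.
Proof.
move=> y0 yv; have [v0|v0] := eqVneq (dot v v) 0.
  exists y; last by rewrite dot_eq0.
  by move/eqP: v0; rewrite dot_eq0 => /eqP ->; rewrite dotC dot0l.
pose x := y + (- (dot y v / dot v v)) *: v.
have xv : dot x v = 0 by rewrite dotDl dotZl mulNr divfK // subrr.
exists x => //; rewrite -[y](_ : x + (dot y v / dot v v) *: v = _); last first.
  by rewrite /x scaleNr addrNK.
rewrite dotC dotDl dotZl [dot v x]dotC xv mulr0 addr0 dot_eq0.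
by rewrite /x scaleNr subr_eq0.
Qed.
End DotProduct.

(** Each i excludes at most the value - a i / b i, so any t larger than all the
|a i / b i| will do. *)
Lemma exists_slope (R : realFieldType) N (a b : nat -> R) :
  exists t, forall i, (i < N)%N -> (a i != 0) || (b i != 0) ->
    a i + t * b i != 0.
Proof.
exists (1 + \sum_(i < N) `|a i / b i|) => i iN.
have [-> /= | b0 _] := eqVneq (b i) 0; first by rewrite mulr0 addr0 orbF.
apply/eqP => /eqP; rewrite addrC addr_eq0 => /eqP.
move/(canRL (mulfK b0)) => tE.
suff : `|a i / b i| < 1 + \sum_(i < N) `|a i / b i|.
  by rewrite tE mulNr => /lt_le_trans/(_ (ler_norm _)); rewrite normrN ltxx.
rewrite (bigD1 (Ordinal iN)) //= addrCA ltrDl ltr_pwDl ?ltr01 //.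
exact: sumr_ge0.
Qed.

(** * Orthogonal representations of T_{m,n} in R^3 *)

(** Adjacency in T_{m,n} as a relation on natural numbers.  Since n enters only
as the number of vertices, vertices can be added, shifted or reversed without
casts between ordinal types. *)
Definition T_nat m : rel nat := fun i j =>
  [|| j == i.+1, i == j.+1,
      (i.+1 == m) && (j == m.+1) | (j.+1 == m) && (i == m.+1)].

Lemma adj_TgraphE m n (i j : 'I_(m + n).+1) :
  adj (Tgraph m n) i j = T_nat m i j.
Proof. by rewrite /= /T_adj /T_nat !eqSS. Qed.

Definition scons T (x : T) (u : nat -> T) : nat -> T :=
  fun i => if i is k.+1 then u k else x.

Section Representations.
Variable R : realType.
Implicit Types (u : nat -> 'rV[R]_3) (N : nat).

Definition represents N (e : rel nat) u := forall i j,
  (i < N)%N -> (j < N)%N -> i != j -> (dot (u i) (u j) == 0) = e i j.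

Definition frame N (c : nat -> R) u : 'M[R]_3 :=
  \sum_(i < N) c i *: ((u i)^T *m u i).

(** Modulo scalar matrices, the u_i^T u_i span positively all the symmetric
matrices.  Only S = 0 is finally needed, but the quantification over S is what
survives the addition of new vectors. *)
Definition flexible N u := forall S : 'M[R]_3, S^T = S ->
  exists c, exists2 a, (forall i, 0 < c i) & frame N c u = S + a%:M.

Definition realizable m n := exists2 u,
  represents (m + n).+1 (T_nat m) u & flexible (m + n).+1 u.

(** The new vector w gets weight 1 and the other weights are chosen to
compensate for its contribution w^T w. *)
Lemma flexible_scons N u w : flexible N u -> flexible N.+1 (scons w u).
Proof.
move=> flex S symS; have [|c [a c0 cS]] := flex (S - w^T *m w).
  by rewrite linearB /= trmx_mul trmxK symS.
exists (scons 1 c), a; first by case=> [|i] /=.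
rewrite /frame big_ord_recl /= scale1r.
by rewrite -[X in _ + X]/(frame N c u) cS addrA [w^T *m w + _]addrC addrNK.
Qed.

Lemma flexible_rev N u : flexible N u -> flexible N (fun i => u (N - i.+1)%N).
Proof.
move=> flex S /flex [c [a c0 cS]].
exists (fun i => c (N - i.+1)%N), a => //.
rewrite -cS /frame (reindex_inj rev_ord_inj) /=.
by apply: eq_bigr => i _; rewrite subnSK // subKn // ltnW.
Qed.

(** In the plane orthogonal to u 0, the vector u 1 has nonzero product with
every u j, j > 0, except u 2, to which it is orthogonal.  A vector p of this plane
not orthogonal to u 2 exists because u 2 and u 0 are not parallel: u 3 is
orthogonal to the first but not to the second.  A generic combination of u 1
and p then works for every j. *)
Lemma leaf_vector m n u : (2 < m)%N -> represents (m + n).+1 (T_nat m) u ->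
  exists w, dot w (u 0%N) = 0 /\
    forall j, (0 < j < (m + n).+1)%N -> dot w (u j) != 0.
Proof.
move=> m3; set N := (m + n).+1 => rep.
have orth i j : (i < N)%N -> (j < N)%N -> i != j -> T_nat m i j ->
    dot (u i) (u j) = 0.
  by move=> iN jN ij; rewrite -(rep i j) // => /eqP.
have north i j : (i < N)%N -> (j < N)%N -> i != j -> ~~ T_nat m i j ->
    dot (u i) (u j) != 0 by move=> iN jN ij; rewrite -(rep i j).
have un0 i j : (i < N)%N -> (j < N)%N -> i != j -> ~~ T_nat m i j -> u i != 0.
  move=> iN jN ij /(north i j iN jN ij).
  by apply: contraNneq => ->; rewrite dot0l.
have [|a|p pu0 pu2] := @exists_orth_neq0 R 3 (u 0%N) (u 2%N).
- by apply: (un0 2 0)%N; rewrite /N /T_nat; lia.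
- have: dot (u 0%N) (u 3%N) != 0 by apply: north; rewrite /N /T_nat; lia.
  have: dot (u 2%N) (u 3%N) = 0 by apply: orth; rewrite /N /T_nat; lia.
  have: u 2%N != 0 by apply: (un0 2 0)%N; rewrite /N /T_nat; lia.
  move=> u2 u23 u03; apply: contraNneq u2 => u2E.
  move/eqP: u23; rewrite u2E dotZl mulf_eq0 (negPf u03) orbF => /eqP ->.
  by rewrite scale0r.
have [t tP] :=
  exists_slope N (fun j => dot (u 1%N) (u j)) (fun j => dot p (u j)).
exists (u 1%N + t *: p); split.
  rewrite dotDl dotZl pu0 mulr0 addr0.
  by apply: orth; rewrite /N /T_nat; lia.
move=> j /andP[j0 jN]; rewrite dotDl dotZl; apply: tP => //.
have [->|j2] := eqVneq j 2%N; first by rewrite pu2 orbT.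
apply/orP; left; have [->|j1] := eqVneq j 1%N.
  by rewrite dot_eq0; apply: (un0 1 3)%N; rewrite /N /T_nat; lia.
by apply: north; rewrite /N /T_nat; lia.
Qed.

Lemma realizable_leaf m n : (2 < m)%N -> realizable m n -> realizable m.+1 n.
Proof.
move=> m3 [u rep flex]; have [w [w0 wu]] := leaf_vector m3 rep.
exists (scons w u); last by rewrite addSn; exact: flexible_scons.
case=> [|i] [|j] //=; rewrite addSn ltnS => iN jN ij.
- have [->|j0] := eqVneq j 0%N; first by rewrite w0 eqxx.
  by rewrite (negPf (wu j _)) ?/T_nat; lia.
- have [->|i0] := eqVneq i 0%N; first by rewrite dotC w0 eqxx.
  by rewrite dotC (negPf (wu i _)) ?/T_nat; lia.
by rewrite rep // /T_nat; lia.
Qed.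

Lemma realizable_sym m n : realizable m n -> realizable n m.
Proof.
rewrite /realizable [(n + m)%N]addnC; move=> [u rep flex].
eexists; last exact: flexible_rev flex.
by move=> i j iN jN ij; rewrite rep /T_nat; lia.
Qed.
End Representations.

(** * Seven vertices, and more *)

Section IntegerVectors.
Variable R : realType.
Implicit Types (s t : int * int * int) (us : seq (int * int * int)).

Definition ivec s : 'rV[R]_3 :=
  \row_k (nth 0 [:: s.1.1; s.1.2; s.2] k)%:~R.

Definition ivecs us (i : nat) : 'rV[R]_3 := ivec (nth (0, 0, 0) us i).

Definition idot s t : int := s.1.1 * t.1.1 + s.1.2 * t.1.2 + s.2 * t.2.

Lemma dot_ivec s t : dot (ivec s) (ivec t) = (idot s t)%:~R.
Proof.
rewrite dotE !big_ord_recl big_ord0 !mxE /= addr0 addrA.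
by rewrite /idot !rmorphD !rmorphM.
Qed.

Definition irepresents m N us := let I := iota 0 N in
  all (fun i => all (fun j => (i == j) ||
    ((idot (nth (0, 0, 0) us i) (nth (0, 0, 0) us j) == 0) == T_nat m i j))
  I) I.

Lemma represents_ivecs m N us :
  irepresents m N us -> represents N (T_nat m) (ivecs us).
Proof.
move=> /allP rep i j iN jN ij.
have := rep i; rewrite mem_iota => /(_ iN)/allP/(_ j).
rewrite mem_iota => /(_ jN); rewrite (negPf ij) /= => /eqP <-.
by rewrite dot_ivec intr_eq0.
Qed.

Lemma frameE N c (u : nat -> 'rV[R]_3) a b :
  frame N c u a b = \sum_(i < N) c i * (u i 0 a * u i 0 b).
Proof.
rewrite summxE; apply: eq_bigr => i _.
by rewrite !mxE big_ord1 !mxE.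
Qed.

Lemma sym3P (A B : 'M[R]_3) : A^T = A -> B^T = B ->
  [/\ A 0 0 = B 0 0, A 1 1 = B 1 1 & A 2 2 = B 2 2] ->
  [/\ A 0 1 = B 0 1, A 0 2 = B 0 2 & A 1 2 = B 1 2] -> A = B.
Proof.
move=> sA sB [d0 d1 d2] [o01 o02 o12].
have tA i j : A i j = A j i by rewrite -{1}sA mxE.
have tB i j : B i j = B j i by rewrite -{1}sB mxE.
have o10 : A 1 0 = B 1 0 by rewrite tA tB.
have o20 : A 2 0 = B 2 0 by rewrite tA tB.
have o21 : A 2 1 = B 2 1 by rewrite tA tB.
have ord3 (i : 'I_3) : [\/ i = 0, i = 1 | i = 2].
  case: i => [[|[|[|i]]] iP] //;
  [apply: Or31 | apply: Or32 | apply: Or33]; exact: val_inj.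
by apply/matrixP => i j; case: (ord3 i) => ->; case: (ord3 j) => ->.
Qed.

Lemma frame_sym N c (u : nat -> 'rV[R]_3) : (frame N c u)^T = frame N c u.
Proof.
apply/matrixP => a b; rewrite mxE !frameE; apply: eq_bigr => i _.
by rewrite [u i 0 b * _]mulrC.
Qed.

Lemma frameD N c c' (u : nat -> 'rV[R]_3) :
  frame N (fun i => c i + c' i) u = frame N c u + frame N c' u.
Proof.
by rewrite /frame -big_split; apply: eq_bigr => i _; rewrite scalerDl.
Qed.

Lemma frame_single N k g (u : nat -> 'rV[R]_3) : (k < N)%N ->
  frame N (fun i => g * (i == k)%:R) u = g *: ((u k)^T *m u k).
Proof.
move=> kN; rewrite /frame (bigD1 (Ordinal kN)) //= eqxx mulr1 big1 ?addr0 //.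
by move=> i ik; rewrite [_ == k](negPf ik) mulr0 scale0r.
Qed.

(** Once the off-diagonal entries are right, the diagonal is corrected by
increasing the weights of the standard basis; a large multiple of the identity
keeps these corrections nonnegative. *)
Lemma flexible_of_offdiag N u k : (k.+2 < N)%N ->
    u k = ivec (1, 0, 0) -> u k.+1 = ivec (0, 0, 1) ->
    u k.+2 = ivec (0, 1, 0) ->
    (forall x y z, exists2 c, (forall i, 0 < c i) &
       let F := frame N c u in [/\ F 0 1 = x, F 0 2 = y & F 1 2 = z]) ->
  flexible N u.
Proof.
move=> kN uk uk1 uk2 off S symS.
have [c c0 [Fx Fy Fz]] := off (S 0 1) (S 0 2) (S 1 2).
set F := frame N c u in Fx Fy Fz.
pose bound i := `|F i i| + `|S i i|.
have bound0 i : 0 <= bound i by rewrite addr_ge0.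
pose a := bound 0 + bound 1 + bound 2.
pose g i := S i i + a - F i i.
have g0 i : bound i <= a -> 0 <= g i.
  rewrite /g /bound; have := ler_norm (F i i); have := ler_norm (- S i i).
  rewrite normrN; lra.
have [b0 b1 b2] := And3 (bound0 0) (bound0 1) (bound0 2).
(* The basis vector of coordinate i sits at index k, k.+2 or k.+1. *)
pose w i l := g i * (l == nth 0%N [:: k; k.+2; k.+1] i)%:R : R.
exists (fun l => c l + (w 0 l + w 2 l + w 1 l)), a.
  have w0 i l : bound i <= a -> 0 <= w i l by move=> ?; rewrite mulr_ge0 ?g0.
  by move=> l; rewrite ltr_wpDr ?c0 ?addr_ge0 ?w0 // /a; lra.
rewrite !frameD !frame_single -/F ?(ltnW kN) //=; last exact: ltnW (ltnW kN).
rewrite uk uk1 uk2; apply: sym3P.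
- by rewrite !(linearD, linearZ) /= !trmx_mul !trmxK frame_sym.
- by rewrite linearD /= symS tr_scalar_mx.
- by split; rewrite !mxE !big_ord1 !mxE /= /g; ring.
- by split; rewrite !mxE !big_ord1 !mxE /= ?Fx ?Fy ?Fz; ring.
Qed.

Ltac solve_offdiag :=
  split; rewrite !frameE !big_ord_recl big_ord0 /= !mxE /=; lra.

Ltac solve_positive x y z :=
  have := (ler_norm x, ler_norm (- x), ler_norm y, ler_norm (- y),
           ler_norm z, ler_norm (- z));
  rewrite !normrN => -[[[[[x1 x2] y1] y2] z1] z2];
  do 7! (case=> /=; first lra); move=> ?; rewrite ?nth_nil; lra.

(** In each of the three cases, the weights solve the three linear equations on
the off-diagonal entries, starting from a positive solution of the homogeneous
system multiplied by t.  Here that solution is (1, 2, 1, 4). *)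
Lemma realizable51 : realizable R 5 1.
Proof.
exists (ivecs [:: (1, 1, 1); (1, -2, 1); (3, 1, -1); (0, 1, 1);
                  (1, 0, 0); (0, 0, 1); (0, 1, 0)]).
  by apply: represents_ivecs; vm_compute.
apply: (@flexible_of_offdiag _ _ 4) => // x y z.
pose t := 1 + `|x| + `|y| + `|z|.
exists (nth 1 [:: t + (x + y) / 2; 2 * t; t + (x - y) / 6;
                  4 * t + z - (x + 2 * y) / 3]); rewrite /t.
  by solve_positive x y z.
by solve_offdiag.
Qed.

(** The homogeneous solution is 1, 3, 5 before the triangle and 3 after it. *)
Lemma realizable42 : realizable R 4 2.
Proof.
exists (ivecs [:: (-3, 1, -2); (1, 1, -1); (0, 1, 1);
                  (1, 0, 0); (0, 0, 1); (0, 1, 0); (1, 0, -1)]).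
  by apply: represents_ivecs; vm_compute.
apply: (@flexible_of_offdiag _ _ 3) => // x y z.
pose t := 1 + `|x| + `|y| + `|z|.
exists (nth 1 [:: t; 3 * t + x; 5 * t + x + z; 1; 1; 1; 3 * t - x - y]).
  by rewrite /t; solve_positive x y z.
by solve_offdiag.
Qed.

(** The homogeneous solution is 1, 2 before the triangle and 4, 2 after it. *)
Lemma realizable33 : realizable R 3 3.
Proof.
exists (ivecs [:: (1, 2, -2); (0, 1, 1); (1, 0, 0); (0, 0, 1); (0, 1, 0);
                  (1, 0, 1); (1, -1, -1)]).
  by apply: represents_ivecs; vm_compute.
apply: (@flexible_of_offdiag _ _ 2) => // x y z.
pose t := 1 + `|x| + `|y| + `|z|.
exists (nth 1 [:: t; 2 * t + x + z; 1; 1; 1; 4 * t - x + y; 2 * t - x]).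
  by rewrite /t; solve_positive x y z.
by solve_offdiag.
Qed.
End IntegerVectors.

Lemma realizable_ge7 (R : realType) m n :
  (0 < n <= m)%N -> (5 < m + n)%N -> realizable R m n.
Proof.
have grow k m0 n0 : (2 < m0)%N -> realizable R m0 n0 ->
    realizable R (k + m0) n0.
  move=> m3 rel; elim: k => // k IH; rewrite addSn.
  by apply: realizable_leaf => //; exact: ltn_addl.
have growto m0 n0 m1 : (2 < m0)%N -> (m0 <= m1)%N ->
    realizable R m0 n0 -> realizable R m1 n0.
  by move=> m3 le01 /(grow (m1 - m0)%N _ _ m3); rewrite subnK.
move=> /andP[n0 le_nm] mn6; case: n n0 le_nm mn6 => [|[|[|n]]] // _ le_nm mn6.
- by apply: growto (realizable51 R); lia.
- by apply: growto (realizable42 R); lia.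
apply: (growto 3%N); first by []; first by lia.
by apply/realizable_sym/(growto 3%N)/realizable33.
Qed.

(** * Bounds for the complement of T_{m,n} *)

Section UpperBounds.
Variables (R : realType) (m n : nat).

Lemma adj_complE (i j : 'I_(m + n).+1) :
  adj (compl (Tgraph m n)) i j = (i != j) && ~~ T_nat m i j.
Proof. by rewrite /= /compl_adj adj_TgraphE. Qed.

Lemma dot_represents (u : nat -> 'rV[R]_3) :
  represents (m + n).+1 (T_nat m) u ->
  forall i j : 'I_(m + n).+1, i != j ->
    ((u i *m (u j)^T) 0 0 != 0) = adj (compl (Tgraph m n)) i j.
Proof.
move=> rep i j ij; rewrite adj_complE ij /=.
by rewrite -[_ 0 0]/(dot (u i) (u j)) rep.
Qed.

Lemma q_compl_le2 : realizable R m n -> (q R (compl (Tgraph m n)) <= 2)%N.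
Proof.
move=> [u rep flex]; have [|c [a c0]] := flex 0; first by rewrite trmx0.
rewrite add0r => Fa; have <- : size ('X - a%:P) = 2%N by exact: size_XsubC.
apply: (q_le_gram (c := fun i => c i) (fun i => c0 i) (dot_represents rep)).
  by rewrite polyXsubC_eq0.
rewrite -[X in horner_mx X _]/(frame (m + n).+1 c u) Fa.
by rewrite rmorphB /= horner_mx_X horner_mx_C subrr.
Qed.

(** The eigenvalues of a + b w^T w are a and a + b |w|^2. *)
Lemma q_compl_le3 (u : nat -> 'rV[R]_3) c a b (w : 'rV[R]_3) :
    represents (m + n).+1 (T_nat m) u -> (forall i, 0 < c i) ->
    frame (m + n).+1 c u = a%:M + b *: (w^T *m w) ->
  (q R (compl (Tgraph m n)) <= 3)%N.
Proof.
move=> rep c0 Fab; pose a' := a + b * dot w w.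
have <- : size (('X - a%:P) * ('X - a'%:P)) = 3%N.
  by rewrite size_mul ?polyXsubC_eq0 // !size_XsubC.
apply: (q_le_gram (c := fun i => c i) (fun i => c0 i) (dot_represents rep)).
  by rewrite mulf_neq0 ?polyXsubC_eq0.
rewrite -[X in horner_mx X _]/(frame (m + n).+1 c u) Fab.
rewrite rmorphM !rmorphB /= horner_mx_X !horner_mx_C /a'.
rewrite [a%:M + _]addrC addrK [(a + _)%:M]raddfD /= opprD addrA addrK.
rewrite -mulmxE mulmxBr mul_mx_scalar -!scalemxAl -!scalemxAr.
rewrite !mulmxA -[w^T *m w *m w^T]mulmxA.
rewrite [w *m w^T]mx11_scalar -/(dot w w) mul_mx_scalar -!scalemxAl.
by rewrite !scalerA mulrAC mulrA subrr.
Qed.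
End UpperBounds.

Section LowerBounds.
Variables (R : realType) (m n : nat).

(** The hypotheses of [q_gt_geodesic] for the complement of T_{m,n} as a
computable test, with the distances h and the path x given by lists. *)
Definition igeodesic (h x : seq nat) :=
  let I := iota 0 (m + n).+1 in let k := (size x).-1 in
  let hh := nth 0%N h in let xx := nth 0%N x in
  let e a b := (a != b) && ~~ T_nat m a b in
  [&& all (fun a => all (fun b => e a b ==> (hh b <= (hh a).+1)%N) I) I,
      all (fun t => (xx t <= m + n)%N && (hh (xx t) == t)) (iota 0 k.+1) &
      all (fun t => e (xx t) (xx t.+1) &&
        all (fun y => e y (xx t.+1) && (hh y <= t)%N ==> (y == xx t)) I)
        (iota 0 k)].

Lemma q_compl_gt h x :
  igeodesic h x -> ((size x).-1 < q R (compl (Tgraph m n)))%N.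
Proof.
move=> /and3P[/allP lip /allP hx /allP uniqx].
have inI (a : 'I_(m + n).+1) : (a : nat) \in iota 0 (m + n).+1.
  by rewrite mem_iota /= add0n ltn_ord.
pose xo t : 'I_(m + n).+1 := inord (nth 0%N x t).
have xoE t : (t <= (size x).-1)%N -> xo t = nth 0%N x t :> nat.
  move=> tk; apply: inordK; rewrite ltnS.
  by have := hx t; rewrite mem_iota => /(_ tk)/andP[].
apply: (@q_gt_geodesic R _ _ (fun a => nth 0%N h a) xo)
  => [a b|t tk|t tk|t y tk].
- rewrite adj_complE => ab.
  by have /allP/(_ b (inI b))/implyP/(_ ab) := lip a (inI a).
- by have := hx t; rewrite mem_iota xoE // => /(_ tk)/andP[_ /eqP].
- have := uniqx t; rewrite mem_iota => /(_ tk)/andP[+ _].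
  by rewrite adj_complE -val_eqE /= !xoE // ltnW.
rewrite adj_complE -val_eqE /= xoE // => ey hy.
have := uniqx t; rewrite mem_iota => /(_ tk)/andP[_ /allP/(_ y (inI y))].
by rewrite ey hy /= => /eqP yE; apply: val_inj; rewrite /= yE xoE // ltnW.
Qed.

Lemma q_compl_ge1 : (0 < q R (compl (Tgraph m n)))%N.
Proof. by apply: (@q_gt_geodesic R _ _ (fun=> 0%N) (fun=> ord0)) => // -[]. Qed.

Lemma q_compl_ge2 : (1 < m)%N -> (0 < n)%N -> (1 < q R (compl (Tgraph m n)))%N.
Proof.
move=> m2 n1; have N3 : (2 < (m + n).+1)%N by lia.
pose o := Ordinal N3.
apply: (@q_gt_geodesic R _ _ (fun i => i != ord0 : nat)
          (fun t => if t is 0%N then ord0 else o)) => //.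
- by move=> a b _; case: (b != ord0).
- by case=> [|[]].
- by move=> [|t] // _; rewrite adj_complE /o -val_eqE /T_nat /=; lia.
by move=> [|t] y //= _ _; case: eqP.
Qed.
End LowerBounds.

(** * At most six vertices *)

Section SmallCases.
Variable R : realType.

Lemma q_compl11 : q R (compl (Tgraph 1 1)) = 1%N.
Proof.
apply/eqP; rewrite eqn_leq q_compl_ge1 andbT.
have S0 : S_of (compl (Tgraph 1 1)) (0 : 'M[R]_3).
  split=> [|i j ij]; first exact: trmx0.
  rewrite mxE eqxx adj_complE ij; split=> //.
  by case: i j ij => [[|[|[|i]]] iP] [[|[|[|j]]] jP].
have [_ /(_ _ S0) /leq_trans -> //] := qP R (compl (Tgraph 1 1)).
suff : (qmx (0 : 'M[R]_3) < size ('X : {poly R}))%N by rewrite size_polyX.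
apply: qmx_lt_annihilator.
  by rewrite polyX_eq0.
exact: horner_mx_X.
Qed.

Lemma q_compl22 : q R (compl (Tgraph 2 2)) = 4%N.
Proof.
have gt_q := (@q_compl_gt R 2 2 [:: 1; 3; 2; 0; 2] [:: 3; 0; 4; 1])%N.
apply/eqP; rewrite eqn_leq gt_q //.
rewrite andbT; pose u : nat -> 'rV[R]_3 :=
  ivecs R [:: (0, 1, 1); (1, 0, 0); (0, 0, 1); (0, 1, 0); (1, 0, 1)].
apply: (@q_le_gram_dim _ _ _ _ (fun i => u i)); apply: dot_represents.
by apply: represents_ivecs; vm_compute.
Qed.

Ltac solve_entry :=
  rewrite frameE !big_ord_recl big_ord0 !mxE big_ord1 !mxE /=; ring.

Ltac solve_frame := apply: sym3P;
  [ exact: frame_sym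
  | by rewrite linearD linearZ /= tr_scalar_mx trmx_mul trmxK
  | by split; solve_entry | by split; solve_entry ].

(** In the next four lemmas the weights make the frame operator equal to the
sum of a scalar matrix and a multiple of w^T w: first w is read off the
off-diagonal entries, and then the weights of the standard basis are adjusted
to match the diagonal. *)
Lemma q_compl21 : q R (compl (Tgraph 2 1)) = 3%N.
Proof.
have gt_q := (@q_compl_gt R 2 1 [:: 1; 2; 0; 2] [:: 2; 0; 3])%N.
apply/eqP; rewrite eqn_leq gt_q //.
rewrite andbT.
apply: (@q_compl_le3 _ _ _
  (ivecs R [:: (0, 1, 1); (1, 0, 0); (0, 0, 1); (0, 1, 0)])
  (fun=> 1) 1 1 (ivec R (0, 1, 1))).
- by apply: represents_ivecs; vm_compute.
- by move=> _; exact: ltr01.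
- by solve_frame.
Qed.

Lemma q_compl31 : q R (compl (Tgraph 3 1)) = 3%N.
Proof.
have gt_q := (@q_compl_gt R 3 1 [:: 1; 3; 0; 2; 2] [:: 2; 0; 3])%N.
apply/eqP; rewrite eqn_leq gt_q //.
rewrite andbT.
apply: (@q_compl_le3 _ _ _
  (ivecs R [:: (1, 1, -1); (0, 1, 1); (1, 0, 0); (0, 0, 1); (0, 1, 0)])
  (nth 1 [:: 1; 2; 3; 1; 1]) 5 (-1) (ivec R (1, -1, 1))).
- by apply: represents_ivecs; vm_compute.
- by do 5! (case=> /=; first lra); move=> ?; rewrite nth_nil.
- by solve_frame.
Qed.

Lemma q_compl41 : q R (compl (Tgraph 4 1)) = 3%N.
Proof.
have gt_q := (@q_compl_gt R 4 1 [:: 1; 2; 0; 2; 1; 1] [:: 2; 0; 3])%N.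
apply/eqP; rewrite eqn_leq gt_q //.
rewrite andbT.
apply: (@q_compl_le3 _ _ _
  (ivecs R [:: (1, 1, 2); (1, 1, -1); (0, 1, 1);
               (1, 0, 0); (0, 0, 1); (0, 1, 0)])
  (nth 1 [:: 4; 2; 6; 10; 1; 13]) 13 3 (ivec R (1, 2, 2))).
- by apply: represents_ivecs; vm_compute.
- by do 6! (case=> /=; first lra); move=> ?; rewrite nth_nil.
- by solve_frame.
Qed.

Lemma q_compl32 : q R (compl (Tgraph 3 2)) = 3%N.
Proof.
have gt_q := (@q_compl_gt R 3 2 [:: 1; 2; 0; 2; 2; 1] [:: 2; 0; 4])%N.
apply/eqP; rewrite eqn_leq gt_q //.
rewrite andbT.
apply: (@q_compl_le3 _ _ _
  (ivecs R [:: (1, 1, -1); (0, 1, 1);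
               (1, 0, 0); (0, 0, 1); (0, 1, 0); (1, 0, 2)])
  (nth 1 [:: 1; 2; 6; 1; 5; 1]) 7 1 (ivec R (1, 1, 1))).
- by apply: represents_ivecs; vm_compute.
- by do 6! (case=> /=; first lra); move=> ?; rewrite nth_nil.
- by solve_frame.
Qed.
End SmallCases.

(** * A clique cover of T_{m,n} *)

Section CliqueCover.
Variable R : realType.

(** The k-th clique consists of the vertices k and k+1 for k < m - 1, of the
triangle for k = m - 1, and of k+1 and k+2 for k >= m. *)
Definition in_clique m (k i : nat) :=
  (k + (m <= k) <= i <= k.+1 + (m <= k.+1))%N.

Lemma T_nat_clique m n i j : (i != j) -> (i <= m.+1 + n.+1)%N ->
    (j <= m.+1 + n.+1)%N ->
  T_nat m.+1 i j =
    [exists k : 'I_(m + n).+1, in_clique m.+1 k i && in_clique m.+1 k j].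
Proof.
move=> ij iN jN; apply/idP/existsP => [Tij | [k]]; last first.
  by have := ltn_ord k; rewrite /in_clique /T_nat; lia.
(* An edge with least vertex l lies in clique l if l is at most the first
   vertex of the triangle, and in clique l - 1 otherwise. *)
pose l := minn i j.
have kP : (l - (m < l) < (m + n).+1)%N.
  by move: Tij; rewrite /l /T_nat; lia.
exists (Ordinal kP) => /=; move: Tij; rewrite /in_clique /T_nat /l; lia.
Qed.

Lemma q_Tgraph_le m n : (q R (Tgraph m.+1 n.+1) <= m.+1 + n.+1)%N.
Proof.
pose u i : 'rV[R]_(m + n).+1 := \row_k (in_clique m.+1 k i)%:R.
apply: (@leq_trans (m + n).+2); last by rewrite addSn addnS.
apply: (@q_le_gram_dim _ _ _ _ (fun i => u i)) => i j ij.
rewrite adj_TgraphE (@T_nat_clique m n) //;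
  [|exact: (ltn_ord i)|exact: (ltn_ord j)].
rewrite -[_ 0 0]/(dot (u i) (u j)) dotE.
rewrite (eq_bigr (fun k : 'I_ _ =>
  (in_clique m.+1 k i && in_clique m.+1 k j)%:R)); last first.
  by move=> k _; rewrite !mxE -natrM mulnb.
rewrite psumr_eq0 => [|k _]; last exact: ler0n.
rewrite -has_predC; apply/hasP/existsP => [[k _]|[k kP]].
  by rewrite /= pnatr_eq0 eqb0 negbK => ?; exists k.
by exists k; rewrite ?mem_index_enum //= kP oner_eq0.
Qed.
End CliqueCover.

Lemma q_compl_compl (R : realType) n (G : sgraph n) :
  q R (compl (compl G)) = q R G.
Proof.
have adjE i j : i != j -> adj (compl (compl G)) i j = adj G i j.
  by move=> ij; rewrite /= /compl_adj /= /compl_adj ij /= negbK.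
have SE (A : 'M[R]_n) : S_of (compl (compl G)) A <-> S_of G A.
  by split=> -[sA pA]; split=> // i j ij; rewrite pA // adjE.
have [[A /SE SA qA] lowA] := qP R (compl (compl G)).
have [[B /SE SB qB] lowB] := qP R G.
by apply/eqP; rewrite eqn_leq -{2}qA -{1}qB lowA // lowB.
Qed.

(** * The theorem *)

Theorem corollary4p6 (R : realType) (m n : nat) (hn : (1 <= n)%N) (hmn : (n <= m)%N) :
  q R (compl (Tgraph m n)) =
    (if (m, n) == (1, 1)%N then 1%N
     else if (m, n) == (2, 2)%N then 4%N
     else if (m, n) \in [:: (2, 1); (3, 1); (4, 1); (3, 2)]%N then 3%N
     else 2%N)
  /\ ((m, n) <> (2, 2)%N ->
      forall G : sgraph (m + n).+1,
        G = Tgraph m n \/ G = compl (Tgraph m n) ->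
        (q R G + q R (compl G) <= nvertices G + 2)%N).
Proof.
set v := (X in _ = X /\ _).
have qE : q R (compl (Tgraph m n)) = v.
  rewrite /v !inE !xpair_eqE.
  have [mn6|mn6] := leqP (m + n) 5; last first.
    have -> : q R (compl (Tgraph m n)) = 2%N.
      apply/eqP; rewrite eqn_leq q_compl_ge2; [|lia..].
      by rewrite q_compl_le2 //; apply: realizable_ge7; rewrite ?hn.
    by do 3?case: ifP; lia.
  move: hn hmn mn6; clear v.
  case: n => [|[|[|n]]]; case: m => [|[|[|[|[|m]]]]] //; try lia.
  - by rewrite q_compl11.
  - by rewrite q_compl21.
  - by rewrite q_compl31.
  - by rewrite q_compl41.
  - by rewrite q_compl22.
  - by rewrite q_compl32.
split=> // mn22.
have le3 : (q R (compl (Tgraph m n)) <= 3)%N.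
  rewrite qE /v; case: eqP => // _; case: eqP => [/mn22 //|_]; by case: ifP.
have leT : (q R (Tgraph m n) <= m + n)%N.
  by case: m n hn hmn {v qE mn22 le3} => [|m'] [|n'] // _ _; exact: q_Tgraph_le.
by move=> G [->|->]; rewrite ?q_compl_compl /nvertices; lia.
Qed.
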